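(* Suppose that: (a) $f:\mathbb{R}^n\times\mathbb{R}^m\to\mathbb{R}$ is continuous in $(\mathbf{x},\mathbf{y})$; (b) $\mathcal{X}\subseteq\mathbb{R}^n$ and $\mathcal{Y}\subseteq\mathbb{R}^m$ are convex and compact, with $\|\mathbf{x}\|\le D$ for all $\mathbf{x}\in\mathcal{X}$ and $\|\mathbf{y}\|\le D$ for all $\mathbf{y}\in\mathcal{Y}$ for some constant $D>0$; (c) for every $\mathbf{x}\in\mathcal{X}$ there exists $\mathbf{y}\in\mathcal{Y}$ with $A\mathbf{x}+B\mathbf{y}-\mathbf{c}\le\mathbf{0}$. Then (weak duality) $$v(\text{mM-I})\le v(\text{D1})=v(\text{D2})=v(\text{D3}).$$
   Context: Let $A\in\mathbb{R}^{k\times n}$, $B\in\mathbb{R}^{k\times m}$, $\mathbf{c}\in\mathbb{R}^k$; vector inequalities are componentwise. The primal problem is (mM-I): $\min_{\mathbf{x}\in\mathcal{X}}\big(\max_{\mathbf{y}\in\mathcal{Y},\,A\mathbf{x}+B\mathbf{y}\le\mathbf{c}} f(\mathbf{x},\mathbf{y})\big)$. Its Lagrangian is $L(\mathbf{x},\mathbf{y},\boldsymbol{\lambda})=f(\mathbf{x},\mathbf{y})-\boldsymbol{\lambda}^T(A\mathbf{x}+B\mathbf{y}-\mathbf{c})$ with multiplier $\boldsymbol{\lambda}\in\mathbb{R}^k$, $\boldsymbol{\lambda}\ge\mathbf{0}$. The dual problems are (D1): $\min_{\mathbf{x}\in\mathcal{X}}\big(\min_{\boldsymbol{\lambda}\ge\mathbf{0}}\max_{\mathbf{y}\in\mathcal{Y}}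 L(\mathbf{x},\mathbf{y},\boldsymbol{\lambda})\big)$, (D2): $\min_{\boldsymbol{\lambda}\ge\mathbf{0}}\big(\min_{\mathbf{x}\in\mathcal{X}}\max_{\mathbf{y}\in\mathcal{Y}} L(\mathbf{x},\mathbf{y},\boldsymbol{\lambda})\big)$, (D3): $\min_{\boldsymbol{\lambda}\ge\mathbf{0},\,\mathbf{x}\in\mathcal{X}}\big(\max_{\mathbf{y}\in\mathcal{Y}} L(\mathbf{x},\mathbf{y},\boldsymbol{\lambda})\big)$. $v(P)$ denotes the optimal objective value of problem $P$ (min and max are read as inf and sup if not attained). *)

(* Defs.v *)
From HB Require Import structures.
From mathcomp Require Import all_boot all_order all_algebra.
From mathcomp Require Import all_classical all_reals all_analysis.

Set Implicit Arguments.
Unset Strict Implicit.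
Unset Printing Implicit Defensive.

Import Order.TTheory GRing.Theory Num.Theory.
Import numFieldNormedType.Exports.

Local Open Scope classical_set_scope.
Local Open Scope ring_scope.

(* The library's [<=] is not available on matrices; its norm on ['cV[R]_n]
   is the max norm, hence a separate Euclidean norm. *)
Definition lev (R : realType) (k : nat) (u v : 'cV[R]_k) : Prop :=
  forall i : 'I_k, u i ord0 <= v i ord0.

Definition enorm (R : realType) (n : nat) (x : 'cV[R]_n) : R :=
  Num.sqrt (\sum_(i < n) x i ord0 ^+ 2).

Definition feasible_y (R : realType) (k n m : nat)
    (A : 'M[R]_(k, n)) (B : 'M[R]_(k, m)) (c : 'cV[R]_k)
    (Y : set 'cV[R]_m) (x : 'cV[R]_n) : set 'cV[R]_m :=
  [set y | Y y /\ lev (A *m x + B *m y) c].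

Definition lagrangian (R : realType) (k n m : nat)
    (f : 'cV[R]_n * 'cV[R]_m -> R)
    (A : 'M[R]_(k, n)) (B : 'M[R]_(k, m)) (c : 'cV[R]_k)
    (x : 'cV[R]_n) (y : 'cV[R]_m) (l : 'cV[R]_k) : R :=
  f (x, y) - (l^T *m (A *m x + B *m y - c)) ord0 ord0.

(* Optimal values live in [\bar R]: min and max are inf and sup, with
   inf of the empty set [+oo] and sup of the empty set [-oo]. *)
Definition v_mMI (R : realType) (k n m : nat)
    (f : 'cV[R]_n * 'cV[R]_m -> R)
    (A : 'M[R]_(k, n)) (B : 'M[R]_(k, m)) (c : 'cV[R]_k)
    (X : set 'cV[R]_n) (Y : set 'cV[R]_m) : \bar R :=
  ereal_inf [set ereal_sup [set (f (x, y))%:E | y in feasible_y A B c Y x]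
            | x in X].

Definition v_D1 (R : realType) (k n m : nat)
    (f : 'cV[R]_n * 'cV[R]_m -> R)
    (A : 'M[R]_(k, n)) (B : 'M[R]_(k, m)) (c : 'cV[R]_k)
    (X : set 'cV[R]_n) (Y : set 'cV[R]_m) : \bar R :=
  ereal_inf [set ereal_inf
      [set ereal_sup [set (lagrangian f A B c x y l)%:E | y in Y]
      | l in [set l' | lev 0 l']]
    | x in X].

Definition v_D2 (R : realType) (k n m : nat)
    (f : 'cV[R]_n * 'cV[R]_m -> R)
    (A : 'M[R]_(k, n)) (B : 'M[R]_(k, m)) (c : 'cV[R]_k)
    (X : set 'cV[R]_n) (Y : set 'cV[R]_m) : \bar R :=
  ereal_inf [set ereal_inf
      [set ereal_sup [set (lagrangian f A B c x y l)%:E | y in Y]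
      | x in X]
    | l in [set l' | lev 0 l']].

Definition v_D3 (R : realType) (k n m : nat)
    (f : 'cV[R]_n * 'cV[R]_m -> R)
    (A : 'M[R]_(k, n)) (B : 'M[R]_(k, m)) (c : 'cV[R]_k)
    (X : set 'cV[R]_n) (Y : set 'cV[R]_m) : \bar R :=
  ereal_inf [set ereal_sup [set (lagrangian f A B c x y l)%:E | y in Y]
            | l in [set l' | lev 0 l'] & x in X].

(* Main.v *)
Require Import Defs.
From HB Require Import structures.
From mathcomp Require Import all_boot all_order all_algebra.
From mathcomp Require Import all_classical all_reals all_analysis.
Import Order.TTheory GRing.Theory Num.Theory.
Import numFieldNormedType.Exports.
Local Open Scope classical_set_scope.
Local Open Scope ring_scope.

(** The three dual problems take the infimum of the same quantity
    [sup_y L(x, y, l)] over the same pairs [(x, l)], only grouped differently;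
    an iterated infimum is the infimum over all pairs ([ereal_inf_iter]), so
    the three values coincide.  The remaining inequality is weak duality: at a
    point [y] feasible for [x] the penalty [l^T (A x + B y - c)] is nonpositive
    whenever [l >= 0], so [L(x, y, l)] dominates [f(x, y)] there
    ([lagrangian_ge]).  Hence, for every [x] and every [l >= 0], the inner
    maximum of the primal problem is at most the supremum of [L(x, ., l)] over
    the larger set [Y]. *)

Lemma ereal_inf_iter (R : realType) (S T : Type) (P : set S) (Q : set T)
    (g : S -> T -> \bar R) :
  ereal_inf [set ereal_inf [set g s t | t in Q] | s in P] =
  ereal_inf [set g s t | s in P & t in Q].
Proof.
apply/eqP; rewrite eq_le; apply/andP; split.
- apply: le_ereal_inf_tmp => _ [s Ps [t Qt <-]].
  apply: (@le_trans _ _ (ereal_inf [set g s t | t in Q])).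
    by apply: ereal_inf_lbound; exists s.
  by apply: ereal_inf_lbound; exists t.
- apply: le_ereal_inf_tmp => _ [s Ps <-]; apply: le_ereal_inf_tmp => _ [t Qt <-].
  by apply: ereal_inf_lbound; exists s => //; exists t.
Qed.

Lemma ereal_inf_exchange (R : realType) (S T : Type) (P : set S) (Q : set T)
    (g : S -> T -> \bar R) :
  ereal_inf [set ereal_inf [set g s t | t in Q] | s in P] =
  ereal_inf [set ereal_inf [set g s t | s in P] | t in Q].
Proof.
rewrite !ereal_inf_iter; congr ereal_inf.
by apply/seteqP; split=> _ [a Ha [b Hb <-]]; exists b => //; exists a.
Qed.

(** Each term [l_i (A x + B y - c)_i] of the penalty is a product of a
    nonnegative multiplier and a nonpositive slack, so subtracting the penalty
    cannot decrease the objective. *)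
Lemma lagrangian_ge (R : realType) (k n m : nat)
    (f : 'cV[R]_n * 'cV[R]_m -> R)
    (A : 'M[R]_(k, n)) (B : 'M[R]_(k, m)) (c : 'cV[R]_k)
    (x : 'cV[R]_n) (y : 'cV[R]_m) (l : 'cV[R]_k) :
  lev 0 l -> lev (A *m x + B *m y) c -> f (x, y) <= lagrangian f A B c x y l.
Proof.
move=> l_ge0 y_feas; rewrite /lagrangian lerDl oppr_ge0 mxE.
apply: sumr_le0 => i _; apply: mulr_ge0_le0.
  by have := l_ge0 i; rewrite !mxE.
by rewrite mxE [(- c) _ _]mxE subr_le0; apply: y_feas.
Qed.

Theorem theorem3p2 (R : realType) (k n m : nat)
    (A : 'M[R]_(k, n)) (B : 'M[R]_(k, m)) (c : 'cV[R]_k)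
    (f : 'cV[R]_n * 'cV[R]_m -> R)
    (X : set 'cV[R]_n) (Y : set 'cV[R]_m) (D : R)
    (f_cont : continuous f)
    (X_convex : convex_set X) (X_compact : compact X)
    (Y_convex : convex_set Y) (Y_compact : compact Y)
    (D_gt0 : 0 < D)
    (X_bound : forall x, X x -> enorm x <= D)
    (Y_bound : forall y, Y y -> enorm y <= D)
    (feas : forall x, X x ->
       exists2 y, Y y & lev (A *m x + B *m y - c) 0) :
  [/\ (v_mMI f A B c X Y <= v_D1 f A B c X Y)%E,
      v_D1 f A B c X Y = v_D2 f A B c X Y &
      v_D2 f A B c X Y = v_D3 f A B c X Y].
Proof.
split; last exact: ereal_inf_iter; last exact: ereal_inf_exchange.
apply: le_ereal_inf_tmp => _ [x Xx <-]; apply: le_ereal_inf_tmp => _ [l l_ge0 <-].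
apply: (@le_trans _ _
  (ereal_sup [set (f (x, y))%:E | y in feasible_y A B c Y x])).
  by apply: ereal_inf_lbound; exists x.
apply: ge_ereal_sup => _ [y [Yy y_feas] <-].
apply: (@le_trans _ _ (lagrangian f A B c x y l)%:E).
  by rewrite lee_fin; apply: lagrangian_ge.
by apply: ereal_sup_ubound; exists y.
Qed.
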